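(* Let $\Phi$ be a twisted affine root system such that $\mathring\Phi$ is reduced, i.e. $\Phi=\{\alpha\oplus\mathbb Z:\alpha\in\mathring\Phi_s\}\cup\{\alpha\oplus m\mathbb Z:\alpha\in\mathring\Phi_\ell\}$ with $\mathring\Phi$ a non-simply-laced irreducible reduced finite root system of lacing number $m$. A root subsystem $\Psi$ of $\Phi$ is a maximal root subsystem if and only if one of the following holds: (1) $\mathrm{Gr}(\Psi)$ is a maximal root subsystem of $\mathring\Phi$ such that $\mathrm{Gr}(\Psi)\neq\mathring\Phi_\ell$ and $\Psi=\widehat{\mathrm{Gr}(\Psi)}$. (2) $\mathrm{Gr}(\Psi)=\mathring\Phi$ and there exists a $\mathbb Z$-linear function $p:\mathrm{Gr}(\Psi)\to\mathbb Z$ with $p_\alpha\in Y_\alpha(\Psi)$ for all $\alpha\in\mathrm{Gr}(\Psi)$ such that one of the following holds: (a) $\Psi=\{\alpha\oplus(p_\alpha+m\mathbb Z):\alpha\in\mathring\Phi\}$; (b) there exists a prime $q$ with $\gcd(m,q)=1$ such that $\Psi=\{\alpha\oplus(p_\alpha+q\mathbb Z):\alpha\in\mathring\Phi_s\}\cup\{\alpha\oplus(p_\alpha+mq\mathbb Z):\alpha\in\mathring\Phi_\ell\}$.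
   Context: $\mathring\Phi$ is a finite crystallographic root system in a Euclidean space $V$ with short roots $\mathring\Phi_s$ and long roots $\mathring\Phi_\ell$, and $m\in\{2,3\}$ is its lacing number. Put $\Lambda_\alpha=\Lambda_s=\mathbb Z$ for $\alpha\in\mathring\Phi_s$ and $\Lambda_\alpha=\Lambda_\ell=m\mathbb Z$ for $\alpha\in\mathring\Phi_\ell$. Then $\Phi=\bigcup_{\alpha\in\mathring\Phi}\alpha\oplus\Lambda_\alpha\subseteq V\oplus\mathbb R$ (real roots only), where $\alpha\oplus A=\{\alpha\oplus a:a\in A\}$, with form $(v_1\oplus y_1,v_2\oplus y_2)=(v_1,v_2)$ and reflections $s_\gamma(x)=x-\frac{2(x,\gamma)}{(\gamma,\gamma)}\gamma$. A set $\{\alpha\oplus A_\alpha:\alpha\in T\}$ means $\bigcup_{\alpha\in T}\alpha\oplus A_\alpha$. A root subsystem of $\Phi$ (or of $\mathring\Phi$) is a non-empty subset $\Psi$ with $s_\alpha(\beta)\in\Psi$ for all $\alpha,\beta\in\Psi$; it is maximal if it is proper and not strictly contained in another proper root subsystem. $\mathrm{Gr}(\Psi)=\{\alpha\in\mathring\Phi:\exists y\in\Lambda_\alpha,\ \alpha\oplus y\in\Psi\}$, $Y_\alpha(\Psi)=\{y\in\Lambda_\alpha:\alpha\oplus y\in\Psi\}$, and $\widehat T=\bigcup_{\alpha\in T}\alpha\oplus\Lambda_\alpha$ for $T\subseteq\mathring\Phi$. A $\mathbb Z$-linear function on $\mathring\Phi$ is the restriction to $\mathring\Phi$ of a group homomorphism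 from the root lattice $\mathbb Z\mathring\Phi$. *)

(* Defs.v *)
From HB Require Import structures.
From mathcomp Require Import all_boot all_order all_algebra.
From mathcomp Require Import boolp classical_sets cardinality reals.

Set Implicit Arguments.
Unset Strict Implicit.
Unset Printing Implicit Defensive.

Import Order.TTheory GRing.Theory Num.Theory.
Local Open Scope classical_set_scope.
Local Open Scope ring_scope.

Section Reflections.
Context {R : realType} {U : lmodType R}.
Variable form : U -> U -> R.

Definition reflection (g x : U) : U := x - (2 * form x g / form g g) *: g.

Definition root_subsystem (Phi Psi : set U) : Prop :=
  [/\ Psi `<=` Phi, Psi !=set0 &
      forall a b, Psi a -> Psi b -> Psi (reflection a b)].

Definition maximal_root_subsystem (Phi Psi : set U) : Prop :=
  [/\ root_subsystem Phi Psi, Psi `<` Phi &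
      forall Psi', root_subsystem Phi Psi' -> Psi' `<` Phi -> ~ Psi `<` Psi'].

End Reflections.

Section FiniteRootSystems.
Context {R : realType} {V : vectType R}.
Variable dot : {dot V for idfun}.

Definition crystallographic_root_system (Phi : set V) : Prop :=
  [/\ finite_set Phi,
      forall W : {vspace V}, (forall a, Phi a -> a \in W) -> W = fullv,
      ~ Phi 0,
      forall a b, Phi a -> Phi b -> Phi (reflection dot a b) &
      forall a b, Phi a -> Phi b -> 2 * dot b a / dot a a \is a Num.int].

Definition reduced_root_system (Phi : set V) : Prop :=
  forall a (c : R), Phi a -> Phi (c *: a) -> c = 1 \/ c = -1.

Definition irreducible_root_system (Phi : set V) : Prop :=
  Phi !=set0 /\
  forall A B : set V, A !=set0 -> B !=set0 -> Phi = A `|` B ->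
    ~ (forall a b, A a -> B b -> dot a b = 0).

Definition non_simply_laced (Phi : set V) : Prop :=
  exists a b, [/\ Phi a, Phi b & dot a a != dot b b].

Definition short_roots (Phi : set V) : set V :=
  [set a | Phi a /\ forall b, Phi b -> dot a a <= dot b b].

(* An irreducible reduced root system has at most two root lengths. *)
Definition long_roots (Phi : set V) : set V := Phi `\` short_roots Phi.

(* For a non-simply-laced irreducible reduced system: the squared length ratio
   of long to short roots. *)
Definition lacing_number (Phi : set V) (m : nat) : Prop :=
  forall a b, short_roots Phi a -> long_roots Phi b ->
    dot b b = m%:R * dot a a.

(* Group homomorphisms from the root lattice are represented by functions on V
   that are additive on the lattice, their values elsewhere being irrelevant;
   likewise only the values of p on Phi matter. *)
Definition additive_subgroup (L : set V) : Prop :=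
  L 0 /\ forall x y, L x -> L y -> L (x - y).

Definition root_lattice (Phi : set V) : set V := smallest additive_subgroup Phi.

Definition Zlinear (Phi : set V) (p : V -> int) : Prop :=
  exists f : V -> int,
    (forall x y, root_lattice Phi x -> root_lattice Phi y ->
       f (x + y) = f x + f y) /\
    (forall a, Phi a -> p a = f a).

End FiniteRootSystems.

Section AffineRootSystems.
Context {R : realType} {V : vectType R}.
Variable dot : {dot V for idfun}.

Definition affine_form (x y : V * R^o) : R := dot x.1 y.1.

(* c + k Z, as a set of reals *)
Definition int_coset (c : int) (k : nat) : set R :=
  [set (c + k%:Z * z)%:~R | z in [set: int]].

(* { a (+) A_a : a in T } *)
Definition affine_union (T : set V) (A : V -> set R) : set (V * R^o) :=
  \bigcup_(a in T) [set (a, y) | y in A a].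

Variables (Phi : set V) (m : nat).

(* Meaningful for a in Phi only: a root that is not short is long. *)
Definition Lambda (a : V) : set R :=
  if a \in short_roots dot Phi then int_coset 0 1 else int_coset 0 m.

Definition full_lift (T : set V) : set (V * R^o) := affine_union T Lambda.

(* The real roots of the twisted affine root system. *)
Definition twisted_affine : set (V * R^o) := full_lift Phi.

Definition Gr (Psi : set (V * R^o)) : set V :=
  [set a | Phi a /\ exists2 y, Lambda a y & Psi (a, y)].

Definition Yset (Psi : set (V * R^o)) (a : V) : set R :=
  [set y | Lambda a y /\ Psi (a, y)].

End AffineRootSystems.

(* Main.v *)
Require Import Defs.
From mathcomp Require Import all_boot all_order all_algebra.
From mathcomp Require Import boolp classical_sets cardinality reals.
From mathcomp Require Import ring lra zify.

Set Implicit Arguments.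
Unset Strict Implicit.
Unset Printing Implicit Defensive.

Import Order.TTheory GRing.Theory Num.Theory.
Local Open Scope classical_set_scope.
Local Open Scope ring_scope.

(** Let Psi be a subsystem of the twisted affine system, with fibre Y_a over
    a root a.

    If the gradient of Psi is not the whole finite system, Psi lies in the full
    lift of its gradient, so a maximal Psi is such a lift and its gradient is
    maximal.  The long roots are excluded because their lift, all of whose
    heights are divisible by m, lies in the proper subsystem of all pairs
    (a, y) with m dividing y.

    If the gradient is everything, Psi contains the graph of a Z-linear function
    p ([full_gradient_section]): choose elements of Psi over a linearly
    independent set of roots that generates all roots under reflections
    ([exists_free_generators], which finds simple roots), and extend
    linearly; reflections in Psi carry the graph along.  After subtraction of p,
    the fibres depend only on the length of the root, since they are invariant
    under the finite reflection group and roots of equal length are conjugate.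
    The fibre over a short root is an additive group d Z.  Either d = 1, and then
    Psi is the whole affine system, or some prime q divides d; then q
    divides the fibre over long roots as well, so Psi lies in the congruence
    system of p and q, whose fibres are p_a + q Z over short roots and
    p_a + lcm(m, q) Z over long ones ([sub_congruence_system]).

    Congruence systems of prime modulus along the same p are pairwise
    incomparable, so they are exactly the maximal subsystems with full gradient;
    q = m gives the first family of the theorem, q coprime to m the second.
    The same containment shows that the full lift of a maximal T that has a
    short root is maximal: over that root the lift has all of Z, which no
    congruence system allows. *)

(** * Reflections in a Euclidean space *)

Section Reflections.
Context {R : realType} {V : vectType R}.
Variable dot : {dot V for idfun}.
Implicit Types a b u v : V.

Definition cartan a b : R := 2 * dot b a / dot a a.

Lemma dotC u v : dot u v = dot v u.
Proof. by rewrite hermC /= expr0 mul1r. Qed.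

Lemma dot_gt0 u : u != 0 -> 0 < dot u u.
Proof. exact: neq0_dnorm_gt0. Qed.

Lemma dot_le0 u : dot u u <= 0 -> u = 0.
Proof.
move=> le0; apply/eqP; apply: contraT => /dot_gt0.
by rewrite ltNge le0.
Qed.

Lemma dotNl u v : dot (- u) v = - dot u v.
Proof. exact: linearNl. Qed.

Lemma dotNr u v : dot u (- v) = - dot u v.
Proof. exact: linearNr. Qed.

Lemma dotBl u v w : dot (u - v) w = dot u w - dot v w.
Proof. exact: linearBl. Qed.

Lemma dotBr u v w : dot w (u - v) = dot w u - dot w v.
Proof. exact: linearBr. Qed.

Lemma dotDr u v w : dot w (u + v) = dot w u + dot w v.
Proof. exact: linearDr. Qed.

Lemma dotZl k u v : dot (k *: u) v = k * dot u v.
Proof. exact: linearZl_LR. Qed.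

Lemma dotZr k u v : dot u (k *: v) = k * dot u v.
Proof. by rewrite dotC dotZl dotC. Qed.

Lemma dot_suml I (r : seq I) (P : pred I) (F : I -> V) v :
  dot (\sum_(i <- r | P i) F i) v = \sum_(i <- r | P i) dot (F i) v.
Proof. exact: linear_sumlz. Qed.

Lemma reflectionE a b : reflection dot a b = b - cartan a b *: a.
Proof. by []. Qed.

Lemma cartan_self a : a != 0 -> cartan a a = 2.
Proof. by move=> /dot_gt0 a0; rewrite /cartan mulfK ?gt_eqF. Qed.

Lemma reflection_self a : a != 0 -> reflection dot a a = - a.
Proof.
by move=> a0; rewrite reflectionE cartan_self // scaler_nat mulr2n opprD addNKr.
Qed.

Lemma cartanM a b : a != 0 -> cartan a b * dot a a = 2 * dot b a.
Proof. by move=> /dot_gt0 a0; rewrite /cartan divfK ?gt_eqF. Qed.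

Lemma cartanNr a b : cartan a (- b) = - cartan a b.
Proof. by rewrite /cartan dotNl mulrN mulNr. Qed.

Lemma reflectionN a b : reflection dot a (- b) = - reflection dot a b.
Proof. by rewrite !reflectionE cartanNr scaleNr opprD opprK. Qed.

Lemma dot_reflection_root a b :
  a != 0 -> dot (reflection dot a b) a = - dot b a.
Proof.
move=> a0; rewrite reflectionE dotBl dotZl cartanM //; ring.
Qed.

Lemma reflectionK a : a != 0 -> involutive (reflection dot a).
Proof.
move=> a0 b; rewrite [LHS]reflectionE /cartan dot_reflection_root //.
by rewrite reflectionE mulrN mulNr scaleNr opprK subrK.
Qed.

Lemma reflection_isometry a b :
  a != 0 -> dot (reflection dot a b) (reflection dot a b) = dot b b.
Proof.
move=> a0; rewrite {2}reflectionE dotBr dotZr dot_reflection_root //.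
rewrite reflectionE dotBl dotZl (dotC a b); ring.
Qed.

(** A Cartan integer of 2 or more would give the difference of the two vectors
    a nonpositive norm. *)
Lemma acute_cartan_eq1 a b :
  b != 0 -> a != b -> dot a a <= dot b b -> 0 < dot a b ->
  cartan b a \is a Num.int -> cartan b a = 1.
Proof.
move=> b0 ab lenab ab0 /intrP[k ck].
have cM := cartanM a b0.
have bb := dot_gt0 b0.
have k0 : (0 < k)%R.
  rewrite -(ltr0z R) -ck -(pmulr_lgt0 _ bb) cM; lra.
suff k2 : (k < 2)%R by rewrite ck (_ : k = 1) //; lia.
rewrite ltNge; apply/negP => k2.
have ck2 : 2 <= cartan b a by rewrite ck (_ : 2 = 2%:~R) // ler_int.
have bb_ab : dot b b <= dot a b.
  have : 2 * dot b b <= cartan b a * dot b b by rewrite ler_wpM2r // ltW.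
  by rewrite cM; lra.
move/eqP: ab; apply; apply/subr0_eq/dot_le0.
rewrite dotBl !dotBr (dotC b a); lra.
Qed.

(** In a vanishing combination, the sum v of the positive terms equals the
    opposite of the sum of the other terms.  Pairwise obtuseness then makes the
    norm of v nonpositive, so that v = 0, whereas a positive term would
    make the scalar product of v with u positive. *)
Lemma obtuse_half_space_free (u : V) (S : seq V) :
  uniq S -> (forall a, a \in S -> 0 < dot a u) ->
  (forall a b, a \in S -> b \in S -> a != b -> dot a b <= 0) ->
  free S.
Proof.
move=> uS posS obS.
have mem (i : 'I_(size S)) : (in_tuple S)`_i \in S by exact: mem_nth.
suff nonpos k : \sum_(i < size S) k i *: (in_tuple S)`_i = 0 ->
    forall i, k i <= 0.
  apply: (introT (@freeP R V _ (in_tuple S))) => k sum0 i; apply/eqP.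
  rewrite eq_le nonpos //= -oppr_le0 (nonpos (fun i => - k i)) //.
  by under eq_bigr do rewrite scaleNr; rewrite sumrN sum0 oppr0.
move=> sum0 i0; rewrite leNgt; apply/negP => ki0.
set X := in_tuple S in mem sum0.
have [Xpos Xobt] : (forall i : 'I_(size S), 0 < dot X`_i u) /\
    (forall i j : 'I_(size S), i != j -> dot X`_i X`_j <= 0).
  split=> [i|i j ij]; first exact: posS.
  by apply: obS => //; rewrite nth_uniq // ltn_ord.
pose v := \sum_(i < size S | 0 < k i) k i *: X`_i.
have vE : v = \sum_(i < size S | ~~ (0 < k i)) - k i *: X`_i.
  move: sum0; rewrite (bigID (fun i => 0 < k i)) /= => /eqP.
  rewrite addr_eq0 => /eqP; rewrite /v => ->; rewrite -sumrN.
  by apply: eq_bigr => i _; rewrite scaleNr.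
have v0 : v = 0.
  apply: dot_le0; rewrite {1}/v dot_suml; apply: sumr_le0 => i ki.
  rewrite dotC vE dot_suml; apply: sumr_le0 => j kj.
  rewrite dotZl dotZr; rewrite -leNgt in kj.
  apply: mulr_ge0_le0; first by rewrite oppr_ge0.
  apply: mulr_ge0_le0; first exact: ltW.
  by apply: Xobt; apply: contraTneq ki => <-; rewrite -leNgt.
have : 0 < dot v u.
  rewrite /v dot_suml (bigD1 i0) //=; apply: ltr_pwDl.
    by rewrite dotZl mulr_gt0.
  by apply: sumr_ge0 => i /andP[ki _]; rewrite dotZl mulr_ge0 // ltW.
by rewrite v0 linear0l ltxx.
Qed.

Lemma exists_regular_vector (s : seq V) :
  0 \notin s -> exists u, forall a, a \in s -> dot a u != 0.
Proof.
elim: s => [|a s IHs]; first by exists 0.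
rewrite inE negb_or eq_sym => /andP[a0 /IHs[u reg_u]].
have [au0|au0] := eqVneq (dot a u) 0; last first.
  by exists u => b; rewrite inE => /predU1P[-> //|]; exact: reg_u.
(* A step larger than every ratio at which some scalar product vanishes. *)
pose e := 1 + \sum_(b <- s) `|dot b u / dot b a|.
have e0 : 0 < e by rewrite ltr_pwDl // sumr_ge0.
exists (u + e *: a) => b; rewrite inE dotDr dotZr => /predU1P[->|bs].
  by rewrite au0 add0r mulf_neq0 ?gt_eqF // dot_gt0.
have [ba0|ba0] := eqVneq (dot b a) 0; first by rewrite ba0 mulr0 addr0 reg_u.
apply: contraT; rewrite negbK => /eqP eq0.
have eE : e = - (dot b u / dot b a).
  by apply: (mulIf ba0); rewrite mulNr divfK //; lra.
have : `|dot b u / dot b a| < e.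
  rewrite /e (big_rem b) //=.
  have : 0 <= \sum_(y <- rem b s) `|dot y u / dot y a| by exact: sumr_ge0.
  lra.
by rewrite -normrN -eE gtr0_norm // ltxx.
Qed.

End Reflections.

(** * Finite root systems *)

Lemma finite_set_argmin (R : realType) (V : choiceType) (f : V -> R)
    (A : set V) :
  finite_set A -> A !=set0 -> exists2 a, A a & forall b, A b -> f a <= f b.
Proof.
move=> /finite_seqP[s As]; rewrite {}As.
elim: s => [|a s IHs]; first by case=> x /=; rewrite in_nil.
move=> _; case: s IHs => [|c s] IHs.
  by exists a => [|b]; rewrite /= inE // => /eqP->.
have [|b bs bmin] := IHs; first by exists c; rewrite /= mem_head.
have [ab|ba] := leP (f a) (f b).
  exists a => [|x]; rewrite /= inE ?eqxx // => /predU1P[->//|/bmin].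
  exact: le_trans.
exists b => [|x]; first by rewrite /= inE [_ \in _]bs orbT.
by rewrite /= inE => /predU1P[->|/bmin//]; exact: ltW.
Qed.

Section FiniteRootSystem.
Context {R : realType} {V : vectType R}.
Variables (dot : {dot V for idfun}) (Phi : set V).
Hypothesis Phi_root : crystallographic_root_system dot Phi.

Notation s_ := (reflection dot).

Definition reflection_closed (A : set V) : Prop :=
  forall a b, A a -> A b -> A (s_ a b).

Definition reflection_span (A : set V) : set V := smallest reflection_closed A.

Lemma reflection_span_closed A : reflection_closed (reflection_span A).
Proof.
move=> a b Aa Ab M MA; have [Mcl _] := MA.
by apply: Mcl; [exact: Aa|exact: Ab].
Qed.

Lemma sub_reflection_span A : A `<=` reflection_span A.
Proof. exact: sub_smallest. Qed.

Lemma root_neq0 {a} : Phi a -> a != 0.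
Proof.
have [_ _ Phi0 _ _] := Phi_root.
by move=> Pa; apply/eqP => a0; apply: Phi0; rewrite -a0.
Qed.

Lemma root_dot_gt0 {a} : Phi a -> 0 < dot a a.
Proof. by move=> /root_neq0; exact: dot_gt0. Qed.

Lemma root_reflection {a b} : Phi a -> Phi b -> Phi (s_ a b).
Proof. by have [_ _ _ + _] := Phi_root; exact. Qed.

Lemma root_cartan_int {a b} : Phi a -> Phi b -> cartan dot a b \is a Num.int.
Proof. by have [_ _ _ _] := Phi_root; exact. Qed.

Lemma rootN {a} : Phi a -> Phi (- a).
Proof.
move=> Pa; rewrite -(reflection_self dot (root_neq0 Pa)).
exact: root_reflection.
Qed.

(** If f (s_a b) > - f b, then s_a b or its opposite is a positive root lower
    than b, and reflecting it back in a gives b or - b.  Otherwise b is longer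
    than a, and c = b - a is a positive root of the length of a, lower than b;
    b has the same Cartan integer k along a and c.  As
    f (s_a b) + f (s_c b) = (2 - k) f b >= - f b, because k is at most 3, the
    root c can be used instead of a. *)
Lemma acute_reflection_span (f : V -> R) (a b : V) :
  reduced_root_system Phi ->
  (forall x y, f (x - y) = f x - f y) ->
  (forall k x, f (k *: x) = k * f x) ->
  (forall x, Phi x -> f x != 0) ->
  Phi a -> Phi b -> 0 < f a -> f a < f b -> 0 < dot a b ->
  reflection_span [set c | [/\ Phi c, 0 < f c & f c < f b]] b.
Proof.
move=> red fB fZ freg Pa Pb fa0 fab ab0.
set G := reflection_span _.
have fb0 : 0 < f b by exact: lt_trans fab.
have f0 : f 0 = 0 by rewrite -(subrr 0) fB subrr.
have fN x : f (- x) = - f x by rewrite -sub0r fB f0 sub0r.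
have low x : Phi x -> 0 < f x -> f x < f b -> G x.
  by move=> Px fx0 fxb; exact: sub_reflection_span.
have span x : Phi x -> 0 < f x -> f x < f b ->
    - f b < f (s_ x b) -> f (s_ x b) < f b -> G b.
  move=> Px fx0 fxb lb ub.
  have Gx : G x by exact: low.
  have Py := root_reflection Px Pb.
  have xK := reflectionK dot (root_neq0 Px) b.
  have := freg _ Py; rewrite neq_lt => /orP[y0|y0]; last first.
    by rewrite -xK; apply: reflection_span_closed => //; exact: low.
  have GNb : G (- b).
    rewrite -xK -reflectionN; apply: reflection_span_closed => //.
    by apply: low; [exact: rootN|rewrite fN; lra|rewrite fN; lra].
  rewrite -[b]opprK -(reflection_self dot (root_neq0 (rootN Pb))).
  exact: reflection_span_closed.
have fs x y : f (s_ x y) = f y - cartan dot x y * f x.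
  by rewrite reflectionE fB fZ.
have nab : a != b by apply: contraTneq fab => ->; rewrite ltxx.
have aa := root_dot_gt0 Pa; have bb := root_dot_gt0 Pb.
have [lab|lba] := leP (dot b b) (dot a a).
  have k1 : cartan dot a b = 1.
    apply: acute_cartan_eq1 => //; [exact: root_neq0|by rewrite eq_sym| |].
      by rewrite dotC.
    exact: root_cartan_int.
  by apply: (span a) => //; rewrite fs k1; lra.
have k1 : cartan dot b a = 1.
  apply: acute_cartan_eq1 => //; [exact: root_neq0|exact: ltW|].
  exact: root_cartan_int.
pose c := b - a.
have cE : c = - s_ b a by rewrite reflectionE k1 scale1r opprB.
have Pc : Phi c by rewrite cE; apply/rootN/root_reflection.
have bb_ab : dot b b = 2 * dot a b.
  by rewrite -(cartanM dot a (root_neq0 Pb)) k1 mul1r.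
have kM := cartanM dot b (root_neq0 Pa).
have ck : cartan dot c b = cartan dot a b.
  have cc : dot c c = dot a a.
    by rewrite cE dotNl dotNr opprK reflection_isometry // root_neq0.
  rewrite {1}/cartan cc /c dotBr bb_ab (dotC dot b a) /cartan (dotC dot b a).
  by congr (_ / _); ring.
have k_gt0 : 0 < cartan dot a b.
  by rewrite -(pmulr_lgt0 _ aa) kM dotC mulr_gt0.
(* From k = 4 on, the norm of a - b / 2 would be nonpositive. *)
have k_le3 : cartan dot a b <= 3.
  have /intrP[k kE] := root_cartan_int Pa Pb.
  have [//|k_gt3] := leP (cartan dot a b) 3.
  have k_ge4 : 4 <= cartan dot a b.
    move: k_gt3; rewrite kE (_ : 3 = 3%:~R) // (_ : 4 = 4%:~R) //.
    by rewrite ltr_int ler_int; lia.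
  have a_half : a = 2^-1 *: b.
    apply/subr0_eq/(dot_le0 (dot := dot)).
    rewrite dotBl !dotBr !dotZl !dotZr (dotC dot b a).
    have : 4 * dot a a <= cartan dot a b * dot a a by rewrite ler_wpM2r // ltW.
    by rewrite kM (dotC dot b a); lra.
  have := red b 2^-1 Pb; rewrite -a_half => /(_ Pa) [] /eqP; lra.
have [lb|ub] := ltP (- f b) (f (s_ a b)).
  by apply: (span a) => //; rewrite fs; nra.
have fc : f c = f b - f a by rewrite /c fB.
apply: (span c) => //; rewrite ?fc; try lra; rewrite fs ck fc.
- rewrite fs in ub; nra.
- nra.
Qed.

(** Simple roots for a regular functional f, here defined as the positive roots
    that reflections do not produce from lower positive roots.  With this
    definition generation is an induction on f, and
    [acute_reflection_span] says that two of them are never acute, whence their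
    linear independence. *)
Lemma exists_free_generators :
  reduced_root_system Phi ->
  exists S : seq V, [/\ free S, forall a, a \in S -> Phi a &
    forall A, reflection_closed A -> (forall a, a \in S -> A a) -> Phi `<=` A].
Proof.
move=> red.
have [Phi_fin _ _ _ _] := Phi_root.
have [r Phi_r] : exists r : seq V, Phi = [set` r] by apply/finite_seqP.
have [|u reg] := exists_regular_vector dot (s := r).
  apply/negP => r0; have : Phi 0 by rewrite Phi_r.
  by move/root_neq0; rewrite eqxx.
pose f v := dot v u.
have fB x y : f (x - y) = f x - f y by exact: dotBl.
have fZ k x : f (k *: x) = k * f x by exact: dotZl.
have fN x : f (- x) = - f x by exact: dotNl.
have freg x : Phi x -> f x != 0 by rewrite Phi_r; exact: reg.
pose lower b := [set c | [/\ Phi c, 0 < f c & f c < f b]].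
pose simple := [set b | [/\ Phi b, 0 < f b & ~ reflection_span (lower b) b]].
have acute a b : simple a -> simple b -> f a < f b -> dot a b <= 0.
  move=> [Pa fa0 _] [Pb _ nb] fab; rewrite leNgt; apply/negP => ab0; apply: nb.
  exact: (acute_reflection_span (a := a)).
have acute_eq a b : simple a -> simple b -> a != b -> f a = f b ->
    dot a a <= dot b b -> dot a b <= 0.
  move=> [Pa fa0 _] [Pb _ nb] nab fab lab; rewrite leNgt; apply/negP => ab0.
  have k1 : cartan dot b a = 1.
    by apply: acute_cartan_eq1 => //; [exact: root_neq0|exact: root_cartan_int].
  have := freg _ (root_reflection Pb Pa).
  by rewrite reflectionE k1 scale1r fB fab subrr eqxx.
have [s sE] : exists s : seq V, simple = [set` s].
  apply/finite_seqP; apply: sub_finite_set Phi_fin.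
  by move=> b [].
have memS a : (a \in undup s) <-> simple a by rewrite mem_undup sE.
exists (undup s); split=> [|a /memS[] //|A Acl SA].
  apply: (obtuse_half_space_free (dot := dot) (u := u)) => [|a /memS[] //|a b].
    exact: undup_uniq.
  move=> /memS Sa /memS Sb nab.
  have [ab|ba|eqab] := ltgtP (f a) (f b); first exact: acute.
    by rewrite dotC; exact: acute.
  have [le|/ltW le] := leP (dot a a) (dot b b); first exact: acute_eq.
  by rewrite dotC; apply: acute_eq => //; rewrite eq_sym.
have posA b : Phi b -> 0 < f b -> A b.
  move=> Pb fb0; apply: contrapT => nAb.
  pose bad := [set c | [/\ Phi c, 0 < f c & ~ A c]].
  have [||c [Pc fc0 nAc] cmin] := finite_set_argmin f (A := bad).
  - by apply: sub_finite_set Phi_fin => c [].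
  - by exists b.
  apply: nAc.
  have lowA : lower c `<=` A.
    move=> d [Pd fd0 fdc]; apply: contrapT => nAd.
    by move: fdc; rewrite ltNge cmin.
  have [Gc|nGc] := EM (reflection_span (lower c) c).
    exact: (smallest_sub Acl lowA).
  by apply/SA/memS.
move=> b Pb; have := freg b Pb; rewrite neq_lt => /orP[fb0|]; last exact: posA.
have ANb : A (- b) by apply: posA; [exact: rootN|rewrite fN oppr_gt0].
rewrite -[b]opprK -(reflection_self dot (root_neq0 (rootN Pb))).
exact: Acl.
Qed.

(** The roots orthogonal to all of S are orthogonal to all other roots: if y is
    not orthogonal to some a in S, a root orthogonal to a and to s_y a is
    orthogonal to y.  Irreducibility leaves no room for the former. *)
Lemma stable_set_not_orthogonal (S : set V) (b : V) :
  irreducible_root_system dot Phi -> S `<=` Phi -> S !=set0 ->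
  (forall a c, Phi a -> S c -> S (s_ a c)) ->
  Phi b -> exists2 a, S a & dot a b != 0.
Proof.
move=> [_ irr] SPhi [c Sc] Sstable Pb; apply: contrapT => orth_b.
pose B := [set d | Phi d /\ exists2 a, S a & dot a d != 0].
pose A := [set d | Phi d /\ forall a, S a -> dot a d = 0].
apply: (irr A B).
- exists b; split=> // a Sa; apply/eqP; apply: contrapT => /negP nab.
  by apply: orth_b; exists a.
- exists c; split; [exact: SPhi|exists c => //].
  by rewrite gt_eqF // root_dot_gt0 //; exact: SPhi.
- apply/seteqP; split=> [d Pd|d [[]|[]] //].
  have [Bd|nBd] := EM (B d); [by right|left; split=> // a Sa].
  by apply/eqP; apply: contrapT => /negP nad; apply: nBd; split=> //; exists a.
- move=> x y [Px Ax] [Py [a Sa ay]].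
  have := Ax _ (Sstable y a Py Sa); rewrite reflectionE dotBl dotZl Ax // sub0r.
  move/eqP; rewrite oppr_eq0 mulf_eq0 dotC => /orP[|/eqP//].
  rewrite /cartan !mulf_eq0 invr_eq0 pnatr_eq0 (negPf ay) /=.
  by rewrite gt_eqF // root_dot_gt0.
Qed.

(** Some conjugate c of a, up to sign, makes an acute angle with b.  If c is not
    b, both Cartan integers are 1, so that s_c b = b - c = - s_b c. *)
Lemma reflection_invariant_same_length (T : Type) (P : V -> T) (a b : V) :
  irreducible_root_system dot Phi ->
  (forall c d, Phi c -> Phi d -> P (s_ c d) = P d) ->
  Phi a -> Phi b -> dot a a = dot b b -> P a = P b.
Proof.
move=> irr invP Pa Pb lab.
have PN c : Phi c -> P (- c) = P c.
  by move=> Pc; rewrite -(reflection_self dot (root_neq0 Pc)) invP.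
pose S := [set c | [/\ Phi c, P c = P a & dot c c = dot a a]].
have [||c d Pc [Pd Pda ld]||c [Pc Pca lc] cb] :=
  stable_set_not_orthogonal (S := S) (b := b) irr.
- by move=> c [].
- by exists a.
- split; [exact: root_reflection|by rewrite invP|].
  by rewrite reflection_isometry // root_neq0.
- exact: Pb.
wlog cb0 : c Pc Pca lc cb / 0 < dot c b.
  move=> WH; move: cb; rewrite neq_lt => /orP[cb|cb]; last first.
    by apply: (WH c) => //; rewrite gt_eqF.
  apply: (WH (- c)); rewrite ?dotNl ?dotNr ?opprK ?oppr_eq0 ?oppr_gt0 //.
  - exact: rootN.
  - by rewrite PN.
  - by rewrite lt_eqF.
have [<-//|ncb] := eqVneq c b.
have cb1 : cartan dot b c = 1.
  by apply: acute_cartan_eq1; rewrite ?lc ?lab ?root_neq0 ?root_cartan_int.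
have bc1 : cartan dot c b = 1.
  apply: acute_cartan_eq1; rewrite ?lc ?lab ?root_neq0 ?root_cartan_int //.
    by rewrite eq_sym.
  by rewrite dotC.
rewrite -Pca -(invP b c) // -(invP c b) // !reflectionE cb1 bc1 !scale1r.
by rewrite -opprB PN // -(scale1r c) -bc1 -reflectionE; exact: root_reflection.
Qed.

(** Reflections preserve the graph of a linear function.  So it is enough that
    the graph meet Psi over a generating set of roots; as that set can be taken
    linearly independent, values can be prescribed on it. *)
Lemma exists_Zlinear_section (Psi : set (V * R^o)) :
  reduced_root_system Phi ->
  (forall x y, Psi x -> Psi y -> Psi (reflection (affine_form dot) x y)) ->
  (forall a, Phi a -> exists z : int, Psi (a, z%:~R)) ->
  exists2 p : V -> int, Zlinear Phi p & forall a, Phi a -> Psi (a, (p a)%:~R).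
Proof.
move=> red Psi_cl Psi_grad.
have [S [freeS SPhi genS]] := exists_free_generators red.
have [h hP] : {h : V -> int & forall a, Phi a -> Psi (a, (h a)%:~R)}.
  apply: (@choice _ _ (fun a z => Phi a -> Psi (a, z%:~R))) => a.
  have [Pa|nPa] := EM (Phi a); last by exists 0.
  by have [z ?] := Psi_grad a Pa; exists z.
pose X := in_tuple S.
have freeX : free X by [].
pose g v : R := \sum_(i < size S) coord X i v * (h X`_i)%:~R.
have gB x y : g (x - y) = g x - g y.
  rewrite /g -sumrB; apply: eq_bigr => i _.
  by rewrite linearB mulrBl.
have gZ k x : g (k *: x) = k * g x.
  by rewrite /g mulr_sumr; apply: eq_bigr => i _; rewrite linearZ mulrA.
pose A := [set a | [/\ Phi a, g a \is a Num.int & Psi (a, g a)]].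
have PhiA : Phi `<=` A.
  apply: genS => [a b [Pa ga Psia] [Pb gb Psib]|a aS].
    have gr : g (s_ a b) = g b - cartan dot a b * g a.
      by rewrite reflectionE gB gZ.
    split; first exact: root_reflection.
      by rewrite gr rpredB // rpredM // root_cartan_int.
    by have := Psi_cl _ _ Psia Psib; rewrite gr.
  have i_lt : (index a S < size S)%N by rewrite index_mem.
  pose i := Ordinal i_lt.
  have Xi : X`_i = a by rewrite /= nth_index.
  have gE : g a = (h a)%:~R.
    rewrite -Xi /g (bigD1 i) // (coord_free i i freeX) eqxx mul1r.
    rewrite big1 => [|j ji].
      exact: addr0.
    by rewrite (coord_free i j freeX) eq_sym (negPf ji) mul0r.
  by split; [exact: SPhi|rewrite gE|rewrite gE; apply/hP/SPhi].
have g_lattice x : root_lattice Phi x -> g x \is a Num.int.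
  apply: (smallest_sub (X := [set x | g x \is a Num.int])); last first.
    by move=> a /PhiA[].
  split=> /=; first by rewrite -[0]/(0 : V) -(subrr 0) gB subrr.
  by move=> y z gy gz; rewrite gB rpredB.
have gD x y : g (x + y) = g x + g y.
  rewrite -[y in LHS]opprK gB -[- y]sub0r gB -(subrr 0) gB; ring.
exists (fun v => Num.floor (g v)).
  exists (fun v => Num.floor (g v)); split=> // x y Lx Ly.
  by rewrite gD floorDzr ?g_lattice.
by move=> a /PhiA[Pa ga Psia]; rewrite floorK.
Qed.

Lemma Zlinear_reflection (p : V -> int) (a b : V) (n : int) :
  Zlinear Phi p -> Phi a -> Phi b -> cartan dot a b = n%:~R ->
  p (s_ a b) = p b - n * p a.
Proof.
move=> [f [fD pf]] Pa Pb cn.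
have L0 : root_lattice Phi 0 by move=> M [[]].
have LB x y :
    root_lattice Phi x -> root_lattice Phi y -> root_lattice Phi (x - y).
  move=> Lx Ly M MP; have [[_ MB] _] := MP.
  by apply: MB; [exact: Lx|exact: Ly].
have LN x : root_lattice Phi x -> root_lattice Phi (- x).
  by move=> Lx; rewrite -sub0r; exact: LB.
have LPhi x : Phi x -> root_lattice Phi x by exact: sub_smallest.
have f0 : f 0 = 0 by have := fD 0 0 L0 L0; rewrite addr0; lia.
have fN x : root_lattice Phi x -> f (- x) = - f x.
  by move=> Lx; have := fD x (- x) Lx (LN x Lx); rewrite subrr f0; lia.
have LfMn k : root_lattice Phi (a *+ k) /\ f (a *+ k) = k%:Z * f a.
  elim: k => [|k [Lk fk]]; first by rewrite mulr0n f0 mul0r.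
  have La : root_lattice Phi (a *+ k.+1).
    rewrite mulrSr -[a in _ + a]opprK; apply: LB => //.
    by apply: LN; exact: LPhi.
  split=> //; rewrite mulrSr fD //; last exact: LPhi.
  rewrite fk; lia.
have LfMz : root_lattice Phi (a *~ n) /\ f (a *~ n) = n * f a.
  case: (n) => k; first exact: LfMn.
  rewrite NegzE -nmulrn; have [Lk fk] := LfMn k.+1.
  by split; [exact: LN|rewrite fN // fk mulNr].
have [Ln fn] := LfMz.
rewrite !pf //; last exact: root_reflection.
rewrite reflectionE cn scaler_int fD ?fN ?fn //; last exact: LN.
exact: LPhi.
Qed.

End FiniteRootSystem.

(** * Sets of integers stable under y - 2 z *)

Section IntegerSets.

Variable A : set int.
Hypotheses (A0 : A 0) (A_step : forall y z, A y -> A z -> A (y - 2 * z)).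

Lemma shift_double y z k : A y -> A z -> A (y + 2 * k * z).
Proof.
move=> Ay Az.
have AN x : A x -> A (- x).
  by move=> Ax; have := A_step Ax Ax; congr A; lia.
case: k => k.
  elim: k => [|k IHk]; first by rewrite mulr0 mul0r addr0.
  by have := A_step IHk (AN z Az); congr A; lia.
rewrite NegzE; elim: k => [|k IHk].
  by have := A_step Ay Az; congr A; lia.
by have := A_step IHk Az; congr A; lia.
Qed.

(** A nonzero A consists of multiples of its least positive element d: modulo
    2 d, an element of A is congruent to an element of A whose absolute value
    is at most d, that is to 0, d or - d. *)
Lemma int_set_full_or_prime_multiple :
  A = setT \/ exists2 q : nat, prime q & forall z, A z -> (q%:Z %| z)%Z.
Proof.
have AN z : A z -> A (- z).
  by move=> Az; have := A_step Az Az; congr A; lia.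
have [[z Az nz0]|triv] := EM (exists2 z, A z & z != 0); last first.
  right; exists 2%N => // z Az; rewrite (_ : z = 0) ?dvdz0 //.
  by apply/eqP; apply: contrapT => /negP nz; apply: triv; exists z.
have exP : exists d : nat, (0 < d)%N && `[< A d%:Z >].
  exists `|z|%N; rewrite absz_gt0 nz0 /=; apply/asboolP.
  by case: (z) Az => k // /AN; rewrite NegzE opprK.
case: (ex_minnP exP) => d /andP[d0 /asboolP Ad] dmin.
have d_dvd x : A x -> (d%:Z %| x)%Z.
  move=> Ax; have Ar := shift_double (- (x %/ (2 * d%:Z))%Z) Ax Ad.
  have xE := divz_eq x (2 * d%:Z).
  have r0 : (0 <= (x %% (2 * d%:Z))%Z)%R by apply: modz_ge0; lia.
  have r1 : ((x %% (2 * d%:Z))%Z < 2 * d%:Z)%R by apply: ltz_pmod; lia.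
  set r := (x %% _)%Z in xE r0 r1; set k := (x %/ _)%Z in xE Ar.
  have {}Ar : A r by move: Ar; congr A; lia.
  have small (y : int) : A y -> (0 < y)%R -> (d%:Z <= y)%R.
    case: y => // y Ay y0; rewrite lez_nat; apply: dmin.
    by apply/andP; split; [lia|exact/asboolP].
  have rd : r = 0 \/ r = d%:Z.
    have [/eqP->|r_neq0] := boolP (r == 0); [by left|right].
    have := small r Ar; have [-> _|r_neq2] := eqVneq (d%:Z) r => //.
    have := small (2 * d%:Z - r).
    rewrite (_ : 2 * d%:Z - r = - r + 2 * 1 * d%:Z); last lia.
    move=> /(_ (shift_double 1 (AN _ Ar) Ad)); lia.
  rewrite xE; apply: rpredD; first by rewrite mulrA dvdz_mull.
  by case: rd => ->; rewrite ?dvdz0.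
have [d1|d1] := eqVneq d 1%N; [left|right].
  apply/seteqP; split=> // x _.
  have xE := divz_eq x 2.
  move: (modz_ge0 x (d := 2) isT) (ltz_pmod x (d := 2) isT).
  set r := (x %% _)%Z in xE *; set k := (x %/ _)%Z in xE => r0 r1.
  have A1 : A 1 by rewrite -[1]/(1%:Z) -d1.
  have Ar : A r.
    have [->//|r_neq0] := eqVneq r 0.
    by rewrite (_ : r = 1) //; lia.
  by rewrite xE (_ : k * 2 + r = r + 2 * k * 1); [exact: shift_double|lia].
exists (pdiv d); first by rewrite pdiv_prime //; lia.
by move=> x /d_dvd; apply: dvdz_trans; exact: pdiv_dvd.
Qed.

End IntegerSets.

(** * Subsystems of the twisted affine root system *)

Section TwistedAffine.
Context {R : realType} {V : vectType R}.
Variables (dot : {dot V for idfun}) (Phi : set V) (m : nat).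
Hypotheses (Phi_root : crystallographic_root_system dot Phi)
  (Phi_reduced : reduced_root_system Phi)
  (Phi_irreducible : irreducible_root_system dot Phi)
  (Phi_nsl : non_simply_laced dot Phi)
  (m_lacing : lacing_number dot Phi m)
  (m_prime : prime m).

Notation s_ := (reflection dot).
Notation short := (short_roots dot Phi).
Notation long := (long_roots dot Phi).
Notation Phi_aff := (twisted_affine dot Phi m).
Notation affine_reflection := (reflection (affine_form dot)).

Lemma short_root a : short a -> Phi a.
Proof. by case. Qed.

Lemma long_root a : long a -> Phi a.
Proof. by case. Qed.

Lemma short_or_long a : Phi a -> short a \/ long a.
Proof. by move=> Pa; have [|] := EM (short a); [left|right]. Qed.

Lemma exists_short : exists a, short a.
Proof.
have [Phi_fin _ _ _ _] := Phi_root; have [Phi0 _] := Phi_irreducible.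
have [a Pa amin] := finite_set_argmin (fun x => dot x x) Phi_fin Phi0.
by exists a.
Qed.

Lemma short_length a b : short a -> short b -> dot a a = dot b b.
Proof. by move=> [Pa ha] [Pb hb]; apply/eqP; rewrite eq_le ha ?hb. Qed.

Lemma exists_long : exists a, long a.
Proof.
have [a [b [Pa Pb nab]]] := Phi_nsl.
have [sa|] := short_or_long Pa; last by exists a.
have [sb|] := short_or_long Pb; last by exists b.
by rewrite (short_length sa sb) eqxx in nab.
Qed.

Lemma short_reflection a b : Phi a -> short b -> short (s_ a b).
Proof.
move=> Pa [Pb bmin]; split=> [|c Pc]; first exact: root_reflection.
by rewrite reflection_isometry ?bmin // (root_neq0 Phi_root).
Qed.

Lemma long_reflection a b : Phi a -> long b -> long (s_ a b).
Proof.
move=> Pa [Pb nsb]; split=> [|sr]; first exact: root_reflection.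
apply: nsb; rewrite -(reflectionK dot (root_neq0 Phi_root Pa) b).
exact: short_reflection.
Qed.

Lemma cartan_lacing a b :
  short a -> long b -> cartan dot a b = m%:R * cartan dot b a.
Proof.
move=> sa lb; rewrite /cartan (m_lacing sa lb) (dotC dot b a).
have a0 : dot a a != 0.
  by rewrite gt_eqF // (root_dot_gt0 Phi_root) //; exact: short_root.
have m0 : m%:R != 0 :> R by rewrite pnatr_eq0 -lt0n prime_gt0.
by field; rewrite a0 m0.
Qed.

Lemma short_lt_long a b : short a -> long b -> dot a a < dot b b.
Proof.
move=> sa lb; rewrite (m_lacing sa lb) ltr_pMl.
  by rewrite ltr1n prime_gt1.
by apply: (root_dot_gt0 Phi_root); exact: short_root.
Qed.

Lemma cartan_long_short a b :
  short a -> long b -> dot a b != 0 ->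
  exists2 e : int, e * e = 1 & cartan dot b a = e%:~R.
Proof.
move=> sa lb; have Pa := short_root sa; have Pb := long_root lb.
have acute c : short c -> 0 < dot c b -> cartan dot b c = 1.
  move=> sc cb0; apply: acute_cartan_eq1 => //.
  - exact: (root_neq0 Phi_root).
  - by apply: contraTneq (short_lt_long sc lb) => ->; rewrite ltxx.
  - exact/ltW/short_lt_long.
  - by apply: (root_cartan_int Phi_root) => //; exact: short_root.
rewrite neq_lt => /orP[ab|ab]; last by exists 1; rewrite ?mulr1 ?acute.
exists (-1); first by rewrite mulrNN mulr1.
have sNa : short (- a).
  rewrite -(reflection_self dot (root_neq0 Phi_root Pa)).
  exact: short_reflection.
apply: oppr_inj; rewrite -cartanNr acute ?dotNl ?oppr_gt0 //.
by rewrite rmorphN opprK.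
Qed.

(** Over a long root the two divisibility conditions amount to divisibility by
    lcm(m, q), which is m when q = m and m q when q is another prime: one
    family covers both kinds of maximal subsystems with full gradient. *)
Definition congruence_system (p : V -> int) (q : nat) : set (V * R^o) :=
  [set x | Phi x.1 /\ exists z : int,
     [/\ x.2 = (p x.1 + z)%:~R, (q%:Z %| z)%Z & long x.1 -> (m%:Z %| z)%Z]].

Definition long_divisible (p : V -> int) : Prop :=
  forall a, long a -> (m%:Z %| p a)%Z.

Lemma int_cosetP (c : int) (k : nat) (y : R) :
  int_coset c k y <-> exists z : int, y = (c + z)%:~R /\ (k%:Z %| z)%Z.
Proof.
split=> [[z _ <-]|[_ [-> /dvdzP[z ->]]]].
  by exists (k%:Z * z); rewrite dvdz_mulr.
by exists z => //; rewrite mulrC.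
Qed.

Lemma affine_unionP (T : set V) (A : V -> set R) a (y : R^o) :
  affine_union T A (a, y) <-> T a /\ A a y.
Proof.
split=> [[b Tb [z Az [<- <-]]]|[Ta Aa]] //.
by exists a => //; exists y.
Qed.

Lemma LambdaP a (y : R) : Phi a ->
  Lambda dot Phi m a y <->
  exists z : int, y = z%:~R /\ (long a -> (m%:Z %| z)%Z).
Proof.
move=> Pa; rewrite /Lambda; case: ifPn; rewrite ?notin_setE ?in_setE => sa.
  rewrite int_cosetP; split=> [[z [-> _]]|[z [-> _]]].
    by exists z; rewrite add0r; split=> // -[].
  by exists z; rewrite add0r dvd1z.
have la : long a by [].
rewrite int_cosetP; split=> [[z [-> mz]]|[z [-> mz]]].
  by exists z; rewrite add0r.
by exists z; rewrite add0r; split=> //; exact: mz.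
Qed.

Lemma full_liftP (T : set V) a (y : R^o) : T `<=` Phi ->
  full_lift dot Phi m T (a, y) <->
  T a /\ exists z : int, y = z%:~R /\ (long a -> (m%:Z %| z)%Z).
Proof.
move=> TPhi; rewrite /full_lift affine_unionP.
by split=> -[Ta]; have Pa := TPhi _ Ta; rewrite LambdaP.
Qed.

Lemma twistedP a (y : R^o) :
  Phi_aff (a, y) <->
  Phi a /\ exists z : int, y = z%:~R /\ (long a -> (m%:Z %| z)%Z).
Proof. exact: full_liftP. Qed.

Lemma full_lift_twisted (T : set V) :
  T `<=` Phi -> full_lift dot Phi m T `<=` Phi_aff.
Proof. by move=> TPhi x [a Ta]; exists a => //; exact: TPhi. Qed.

Lemma affine_reflectionE a b (y z : R^o) :
  affine_reflection (a, y) (b, z) =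
  (s_ a b, (z : R) - cartan dot a b * (y : R)).
Proof. by []. Qed.

(** For b long, the Cartan integer n is divisible by m when a is short, and y
    is when a is long. *)
Lemma reflection_dvd a b (n y z : int) :
  Phi a -> Phi b -> cartan dot a b = n%:~R ->
  (long a -> (m%:Z %| y)%Z) -> (long b -> (m%:Z %| z)%Z) ->
  long (s_ a b) -> (m%:Z %| z - n * y)%Z.
Proof.
move=> Pa Pb cn my mz lab.
have lb : long b.
  rewrite -(reflectionK dot (root_neq0 Phi_root Pa) b).
  exact: long_reflection.
apply: rpredB; first exact: mz.
have [sa|la] := short_or_long Pa; last by rewrite dvdz_mull // my.
have /intrP[n' nE] := root_cartan_int Phi_root Pb Pa.
suff -> : n = m%:Z * n' by rewrite -mulrA dvdz_mulr.
by apply: (@intr_inj R); rewrite -cn cartan_lacing // nE rmorphM.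
Qed.

Lemma full_lift_subsystem (T : set V) :
  root_subsystem dot Phi T ->
  root_subsystem (affine_form dot) Phi_aff (full_lift dot Phi m T).
Proof.
move=> [TPhi [a0 Ta0] Tcl]; split; first exact: full_lift_twisted.
  exists (a0, 0); apply/full_liftP => //; split=> //; exists 0.
  by split=> // _; exact: dvdz0.
move=> [a y] [b z] /full_liftP-/(_ TPhi)[Ta [y' [-> my]]].
move=> /full_liftP-/(_ TPhi)[Tb [z' [-> mz]]].
rewrite affine_reflectionE; apply/full_liftP => //; split; first exact: Tcl.
have Pa := TPhi _ Ta; have Pb := TPhi _ Tb.
have /intrP[n cn] := root_cartan_int Phi_root Pa Pb.
exists (z' - n * y'); split; first by rewrite cn rmorphB rmorphM.
exact: reflection_dvd.
Qed.

Lemma congruence_sub_twisted p q :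
  long_divisible p -> congruence_system p q `<=` Phi_aff.
Proof.
move=> mp [a y] [/= Pa [z [-> _ mz]]]; apply/twistedP; split=> //.
exists (p a + z); split=> // la; apply: rpredD; [exact: mp|exact: mz].
Qed.

Lemma congruence_system_subsystem p q :
  Zlinear Phi p -> long_divisible p ->
  root_subsystem (affine_form dot) Phi_aff (congruence_system p q).
Proof.
move=> plin mp; split; first exact: congruence_sub_twisted.
  have [a sa] := exists_short; exists (a, (p a)%:~R); split.
    exact: short_root.
  by exists 0; rewrite addr0.
move=> [a y] [b z] [/= Pa [y' [-> qy my]]] [/= Pb [z' [-> qz mz]]].
rewrite affine_reflectionE; split; first exact: root_reflection.
have /intrP[n cn] := root_cartan_int Phi_root Pa Pb.
exists (z' - n * y'); split=> /=.
- rewrite (Zlinear_reflection Phi_root plin Pa Pb cn) cn -rmorphM -rmorphB.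
  by congr (_%:~R); ring.
- by apply: rpredB => //; rewrite dvdz_mull.
- exact: reflection_dvd.
Qed.

(** Over a short root a, the height p a + 1 is missing. *)
Lemma congruence_system_proper p q :
  prime q -> long_divisible p -> congruence_system p q `<` Phi_aff.
Proof.
move=> q_pr mp; split; first exact: congruence_sub_twisted.
move=> sub; have [a sa] := exists_short.
have [|_ [z [/= /intr_inj zE qz _]]] := sub (a, (p a + 1)%:~R).
  apply/twistedP; split; first exact: short_root.
  by exists (p a + 1); split=> // -[].
have z1 : z = 1 by lia.
by move: qz; rewrite z1 dvdz1 /= => /eqP q1; rewrite q1 in q_pr.
Qed.

Lemma congruence_system_prime_inj p q q' :
  prime q -> prime q' -> congruence_system p q `<=` congruence_system p q' ->
  q = q'.
Proof.
move=> q_pr q'_pr sub; have [a sa] := exists_short.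
have [|_ [z [/= /intr_inj zE qz _]]] := sub (a, (p a + q%:Z)%:~R).
  by split; [exact: short_root|exists q%:Z; split=> // -[]].
have z1 : z = q%:Z by lia.
by move: qz; rewrite z1 dvdzE /= dvdn_prime2 // => /eqP.
Qed.

Lemma congruence_system_lacing p :
  congruence_system p m = affine_union Phi (fun a => int_coset (p a) m).
Proof.
apply/seteqP; split=> -[a y].
  move=> [/= Pa [z [-> mz _]]]; apply/affine_unionP; split=> //.
  by apply/int_cosetP; exists z.
by move=> /affine_unionP[Pa /int_cosetP[z [-> mz]]]; split=> //; exists z.
Qed.

Lemma congruence_system_coprime p q : coprime m q ->
  congruence_system p q =
  affine_union short (fun a => int_coset (p a) q) `|`
  affine_union long (fun a => int_coset (p a) (m * q)).
Proof.
move=> mq.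
have mqE (z : int) : ((m * q)%N%:Z %| z)%Z = (m%:Z %| z)%Z && (q%:Z %| z)%Z.
  by rewrite !dvdzE /= Gauss_dvd.
apply/seteqP; split=> -[a y].
  move=> [/= Pa [z [-> qz mz]]]; have [sa|la] := short_or_long Pa; [left|right].
    by apply/affine_unionP; split=> //; apply/int_cosetP; exists z.
  apply/affine_unionP; split=> //; apply/int_cosetP; exists z.
  by rewrite mqE qz mz.
move=> [] /affine_unionP[sa /int_cosetP[z [-> ]]].
  by move=> qz; split; [exact: short_root|exists z; split=> // -[]].
by rewrite mqE => /andP[mz qz]; split; [exact: long_root|exists z].
Qed.

Lemma section_long_divisible (Psi : set (V * R^o)) p :
  Psi `<=` Phi_aff -> (forall a, Phi a -> Psi (a, (p a)%:~R)) ->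
  long_divisible p.
Proof.
move=> PsiPhi Psi_p a la.
have /twistedP[_ [y [/intr_inj -> my]]] := PsiPhi _ (Psi_p a (long_root la)).
exact: my.
Qed.

(** After subtraction of p, the fibres F a of Psi are invariant under all
    reflections, so there is one fibre for short roots and one for long
    roots.  Reflecting a root in itself shows that the short fibre is stable
    under y - 2 z: it is Z or lies in some q Z.  In the first case, reflecting
    long roots in short ones, with Cartan integer m or - m, fills the long fibre
    up to m Z, and Psi is everything.  In the second, reflecting short roots
    in long ones, with Cartan integer 1 or - 1, embeds the long fibre in the
    short one. *)
Lemma sub_congruence_system (Psi : set (V * R^o)) p :
  root_subsystem (affine_form dot) Phi_aff Psi -> Psi <> Phi_aff ->
  Zlinear Phi p -> (forall a, Phi a -> Psi (a, (p a)%:~R)) ->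
  exists2 q, prime q & Psi `<=` congruence_system p q.
Proof.
move=> [PsiPhi _ Psi_cl] Psi_neq plin Psi_p.
pose F a := [set z : int | Psi (a, (p a + z)%:~R)].
have F0 a : Phi a -> F a 0 by move=> Pa; rewrite /F /= addr0; exact: Psi_p.
have F_refl a b n y z : Phi a -> Phi b -> cartan dot a b = n%:~R ->
    F a y -> F b z -> F (s_ a b) (z - n * y).
  move=> Pa Pb cn Fy Fz; have := Psi_cl _ _ Fy Fz.
  rewrite affine_reflectionE cn -rmorphM -rmorphB /F /=.
  rewrite (Zlinear_reflection Phi_root plin Pa Pb cn); congr (Psi (_, _%:~R)).
  by ring.
have F_inv a b : Phi a -> Phi b -> F (s_ a b) = F b.
  have sub c d : Phi c -> Phi d -> F d `<=` F (s_ c d).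
    move=> Pc Pd z Fz; have /intrP[n cn] := root_cartan_int Phi_root Pc Pd.
    by have := F_refl c d n 0 z Pc Pd cn (F0 c Pc) Fz; rewrite mulr0 subr0.
  move=> Pa Pb; apply/seteqP; split; last exact: sub.
  rewrite -[in F b](reflectionK dot (root_neq0 Phi_root Pa) b).
  by apply: sub => //; exact: root_reflection.
have F_len a b : Phi a -> Phi b -> dot a a = dot b b -> F a = F b.
  exact: (reflection_invariant_same_length Phi_root Phi_irreducible F_inv).
have mp := section_long_divisible PsiPhi Psi_p.
have F_long a : long a -> forall z, F a z -> (m%:Z %| z)%Z.
  move=> la z.
  move=> /PsiPhi/twistedP[_ [y' [/intr_inj yE my']]].
  rewrite (_ : z = y' - p a); last by lia.
  by apply: rpredB; [exact: my'|exact: mp].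
have Psi_F a y : Psi (a, y) -> Phi a /\ exists2 z, F a z & y = (p a + z)%:~R.
  move=> Pay; have /twistedP[Pa [z [yE _]]] := PsiPhi _ Pay.
  split=> //; exists (z - p a); rewrite /F /= addrC subrK -?yE //.
have [a0 sa0] := exists_short; have Pa0 := short_root sa0.
have [||full|[q q_pr Fq]] := @int_set_full_or_prime_multiple (F a0).
- exact: F0.
- move=> y z Fy Fz.
  have ca : cartan dot a0 a0 = 2%:~R.
    by rewrite cartan_self // (root_neq0 Phi_root).
  by rewrite -(F_inv a0 a0) //; exact: F_refl.
- case: Psi_neq; apply/seteqP; split=> // -[a y] /twistedP[Pa [z [-> mz]]].
  suff : F a (z - p a) by rewrite /F /= addrC subrK.
  have [sa|la] := short_or_long Pa.
    by rewrite (F_len a a0) ?full //; exact: short_length.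
  have [|||b sb ba] := stable_set_not_orthogonal Phi_root Phi_irreducible
    (S := short) (b := a) _ _ _ Pa.
  + by move=> b [].
  + by exists a0.
  + by move=> b c; exact: short_reflection.
  have Pb := short_root sb.
  have [e e1 ce] := cartan_long_short sb la ba.
  have /dvdzP[k kE] : (m%:Z %| z - p a)%Z.
    by apply: rpredB; [exact: mz|exact: mp].
  have cab : cartan dot b a = (m%:Z * e)%:~R.
    by rewrite cartan_lacing // ce rmorphM.
  have Fb : F b (- (e * k)).
    by rewrite (F_len b a0) ?full //; exact: short_length.
  have := F_refl b a _ _ 0 Pb Pa cab Fb (F0 a Pa).
  rewrite F_inv // kE; congr (F a); rewrite sub0r.
  rewrite -[k in RHS]mul1r -e1; ring.
- exists q => // -[a y] /Psi_F[Pa [z Fz ->]]; split=> //=; exists z; split=> //.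
    have [sa|la] := short_or_long Pa.
      by apply: Fq; rewrite -(F_len a) //; exact: short_length.
    have [|||b sb ba] := stable_set_not_orthogonal Phi_root Phi_irreducible
      (S := short) (b := a) _ _ _ Pa.
    + by move=> b [].
    + by exists a0.
    + by move=> b c; exact: short_reflection.
    have Pb := short_root sb.
    have [e e1 ce] := cartan_long_short sb la ba.
    have := F_refl a b e z 0 Pa Pb ce Fz (F0 b Pb).
    rewrite F_inv // (F_len b a0) //; last exact: short_length.
    move=> /Fq qz; rewrite (_ : z = - e * (0 - e * z)); last first.
      by rewrite -[LHS]mul1r -e1; ring.
    by rewrite dvdz_mull.
  by move=> la; exact: F_long Fz.
Qed.

Notation Gr := (Gr dot Phi m).
Notation full_lift := (full_lift dot Phi m).

Lemma GrP (Psi : set (V * R^o)) a : Psi `<=` Phi_aff ->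
  Gr Psi a <-> exists y, Psi (a, y).
Proof.
move=> PsiPhi; split=> [[_ [y _ Py]]|[y Py]]; first by exists y.
have /twistedP[Pa ?] := PsiPhi _ Py.
by split=> //; exists y => //; exact/LambdaP.
Qed.

Lemma sub_full_lift_Gr (Psi : set (V * R^o)) :
  Psi `<=` Phi_aff -> Psi `<=` full_lift (Gr Psi).
Proof.
move=> PsiPhi [a y] Py; apply/full_liftP; first by move=> b [].
by split; [apply/GrP => //; exists y|have /twistedP[] := PsiPhi _ Py].
Qed.

Lemma Gr_subset (Psi Psi' : set (V * R^o)) :
  Psi `<=` Psi' -> Gr Psi `<=` Gr Psi'.
Proof.
by move=> sub a [Pa [y Ly Py]]; split=> //; exists y => //; exact: sub.
Qed.

Lemma Gr_full_lift (T : set V) : T `<=` Phi -> Gr (full_lift T) = T.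
Proof.
move=> TPhi; apply/seteqP; split=> a.
  by move=> [Pa [y _ /full_liftP-/(_ TPhi)[]]].
move=> Ta; apply/GrP; first exact: full_lift_twisted.
exists 0; apply/full_liftP => //; split=> //; by exists 0.
Qed.

Lemma Gr_subsystem (Psi : set (V * R^o)) :
  root_subsystem (affine_form dot) Phi_aff Psi ->
  root_subsystem dot Phi (Gr Psi).
Proof.
move=> [PsiPhi [[a0 y0] Psi0] Psi_cl]; split; first by move=> a [].
  by exists a0; apply/GrP => //; exists y0.
move=> a b /GrP-/(_ PsiPhi)[y Pay] /GrP-/(_ PsiPhi)[z Pbz]; apply/GrP => //.
by exists ((z : R) - cartan dot a b * (y : R)); exact: (Psi_cl _ _ Pay Pbz).
Qed.

Lemma long_subsystem : root_subsystem dot Phi long.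
Proof.
split; first by move=> a [].
  exact: exists_long.
by move=> a b la lb; apply: long_reflection => //; exact: long_root.
Qed.

Lemma long_proper : long `<` Phi.
Proof.
split; first by move=> a [].
by have [a sa] := exists_short => /(_ a (short_root sa)) [].
Qed.

Lemma proper_neq (T : Type) (A B : set T) : A `<=` B -> A <> B -> A `<` B.
Proof. by move=> sub neq; split=> // sub'; apply/neq/seteqP. Qed.

Lemma full_gradient_section (Psi : set (V * R^o)) :
  root_subsystem (affine_form dot) Phi_aff Psi -> Gr Psi = Phi ->
  exists2 p, Zlinear Phi p & forall a, Phi a -> Psi (a, (p a)%:~R).
Proof.
move=> [PsiPhi _ Psi_cl] GrPsi; apply: (exists_Zlinear_section Phi_root) => //.
move=> a; rewrite -{1}GrPsi => /GrP-/(_ PsiPhi)[y Py].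
by have /twistedP[_ [z [yE _]]] := PsiPhi _ Py; exists z; rewrite -yE.
Qed.

(** A subsystem containing the graph of p lies in a congruence system along the
    same p, and two of these with prime moduli are never nested. *)
Lemma congruence_system_maximal p q :
  prime q -> Zlinear Phi p -> long_divisible p ->
  maximal_root_subsystem (affine_form dot) Phi_aff (congruence_system p q).
Proof.
move=> q_pr plin mp; split; first exact: congruence_system_subsystem.
  exact: congruence_system_proper.
move=> Psi' Psi'_sub [_ Psi'_neq] [sub nsub].
have Psi'_p a : Phi a -> Psi' (a, (p a)%:~R).
  move=> Pa; apply: sub; split=> //; by exists 0; rewrite addr0.
have [|q' q'_pr sub'] := sub_congruence_system Psi'_sub _ plin Psi'_p.
  by move=> eq'; apply: Psi'_neq; rewrite eq'.
have := congruence_system_prime_inj q_pr q'_pr (subset_trans sub sub').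
by move=> qq'; apply: nsub; rewrite qq'.
Qed.

(** Being maximal and different from the set of long roots, T contains a short
    root.  All its lifts together lie in no congruence system of prime modulus,
    so a subsystem that contains them and has full gradient is everything. *)
Lemma full_lift_maximal (T : set V) :
  maximal_root_subsystem dot Phi T -> T <> long ->
  maximal_root_subsystem (affine_form dot) Phi_aff (full_lift T).
Proof.
move=> [T_sub T_proper T_max] T_neq; have [TPhi _ _] := T_sub.
have [a Ta sa] : exists2 a, T a & short a.
  apply: contrapT => nT; have T_long : T `<=` long.
    move=> a Ta; have [sa|//] := short_or_long (TPhi _ Ta).
    by case: nT; exists a.
  apply: (T_max long long_subsystem long_proper).
  exact: proper_neq.
have Pa := TPhi _ Ta.
split; first exact: full_lift_subsystem.
  split; first exact: full_lift_twisted.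
  move=> sub; have [_] := T_proper; apply=> b Pb.
  by have := Gr_subset sub; rewrite !Gr_full_lift //; exact.
move=> Psi' Psi'_sub [Psi'Phi Psi'_neq] [sub nsub].
have sub_Gr : T `<=` Gr Psi'.
  by rewrite -{1}(Gr_full_lift TPhi); exact: Gr_subset.
have [GrT|nGrT] := EM (Gr Psi' = T).
  by apply: nsub; rewrite -GrT; exact: sub_full_lift_Gr.
have GrPhi : Gr Psi' = Phi.
  apply: contrapT => nGr; apply: (T_max (Gr Psi')).
  - exact: Gr_subsystem.
  - by apply: proper_neq => // b [].
  - by apply: proper_neq => // /esym.
have [p plin Psi'_p] := full_gradient_section Psi'_sub GrPhi.
have [|q q_pr /(_ (a, (p a + 1)%:~R))] :=
    sub_congruence_system Psi'_sub _ plin Psi'_p.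
  by move=> eq'; apply: Psi'_neq; rewrite eq'.
case.
  apply: sub; apply/full_liftP => //; split=> //.
  by exists (p a + 1); split=> // -[].
move=> _ [z [/= /intr_inj zE qz _]].
have z1 : z = 1 by lia.
by move: qz; rewrite z1 dvdz1 /= => /eqP q1; rewrite q1 in q_pr.
Qed.

Lemma maximal_proper_gradient (Psi : set (V * R^o)) :
  maximal_root_subsystem (affine_form dot) Phi_aff Psi -> Gr Psi <> Phi ->
  [/\ maximal_root_subsystem dot Phi (Gr Psi), Gr Psi <> long &
      Psi = full_lift (Gr Psi)].
Proof.
move=> [Psi_sub Psi_proper Psi_max] Gr_neq.
have [PsiPhi _ _] := Psi_sub.
have Gr_sub := Gr_subsystem Psi_sub; have [GrPhi _ _] := Gr_sub.
have lift_proper T : root_subsystem dot Phi T -> T `<` Phi ->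
    full_lift T `<` Phi_aff.
  move=> [TPhi _ _] [_ nT]; split; first exact: full_lift_twisted.
  by move=> sub; apply: nT; have := Gr_subset sub; rewrite !Gr_full_lift.
have PsiE : Psi = full_lift (Gr Psi).
  apply: contrapT => neq; apply: (Psi_max (full_lift (Gr Psi))).
  - exact: full_lift_subsystem.
  - by apply: lift_proper => //; exact: proper_neq.
  - by apply: proper_neq => //; exact: sub_full_lift_Gr.
split=> //.
- split=> //; first exact: proper_neq.
  move=> T T_sub T_proper [subT nsubT]; have [TPhi _ _] := T_sub.
  apply: (Psi_max (full_lift T)).
  - exact: full_lift_subsystem.
  - exact: lift_proper.
  split=> [x|sub].
    by rewrite PsiE => -[a Ga]; exists a => //; exact: subT.
  by apply: nsubT; rewrite -{1}(Gr_full_lift TPhi); exact: Gr_subset.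
(* The lift of the long roots lies in the congruence system of 0 and m. *)
move=> Gr_long.
pose zero (_ : V) : int := 0.
have zero_lin : Zlinear Phi zero by exists zero.
have zero_div : long_divisible zero by move=> a _; exact: dvdz0.
apply: (Psi_max (congruence_system zero m)).
- exact: congruence_system_subsystem.
- exact: congruence_system_proper.
- split=> [[a y]|sub].
    move=> Pay; have /twistedP[Pa [z [-> mz]]] := PsiPhi _ Pay.
    have la : long a by rewrite -Gr_long; apply/GrP => //; exists y.
    by split=> //; exists z; rewrite add0r; split=> //; exact: mz.
  have [a sa] := exists_short.
  have : Gr Psi a.
    apply/GrP => //; exists 0; apply: sub; split; first exact: short_root.
    by exists 0.
  by rewrite Gr_long => -[].
Qed.

Lemma maximal_full_gradient (Psi : set (V * R^o)) :
  maximal_root_subsystem (affine_form dot) Phi_aff Psi -> Gr Psi = Phi ->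
  exists p q, [/\ prime q, Zlinear Phi p, forall a, Phi a -> Psi (a, (p a)%:~R)
    & Psi = congruence_system p q].
Proof.
move=> [Psi_sub [PsiPhi Psi_neq] Psi_max] GrPhi.
have [p plin Psi_p] := full_gradient_section Psi_sub GrPhi.
have mp := section_long_divisible PsiPhi Psi_p.
have [|q q_pr sub] := sub_congruence_system Psi_sub _ plin Psi_p.
  by move=> eqPsi; apply: Psi_neq; rewrite eqPsi.
exists p, q; split=> //; apply: contrapT => neq.
apply: (Psi_max (congruence_system p q)); last exact: proper_neq.
  exact: congruence_system_subsystem.
exact: congruence_system_proper.
Qed.

End TwistedAffine.

Theorem proposition8 (R : realType) (V : vectType R) (dot : {dot V for idfun})
    (Phi0 : set V) (m : nat) (Psi : set (V * R^o))
    (Phi0_root : crystallographic_root_system dot Phi0)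
    (Phi0_reduced : reduced_root_system Phi0)
    (Phi0_irreducible : irreducible_root_system dot Phi0)
    (Phi0_non_simply_laced : non_simply_laced dot Phi0)
    (m_lacing : lacing_number dot Phi0 m)
    (m23 : m = 2%N \/ m = 3%N)
    (Psi_subsystem :
       root_subsystem (affine_form dot) (twisted_affine dot Phi0 m) Psi) :
  let GrPsi := Gr dot Phi0 m Psi in
  maximal_root_subsystem (affine_form dot) (twisted_affine dot Phi0 m) Psi
  <->
  [/\ maximal_root_subsystem dot Phi0 GrPsi,
      GrPsi <> long_roots dot Phi0 &
      Psi = full_lift dot Phi0 m GrPsi]
  \/
  (GrPsi = Phi0 /\
   exists p : V -> int,
     [/\ Zlinear GrPsi p,
         forall a, GrPsi a -> Yset dot Phi0 m Psi a (p a)%:~R &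
         Psi = affine_union Phi0 (fun a => int_coset (p a) m)
         \/
         (exists q : nat,
            [/\ prime q, coprime m q &
                Psi = affine_union (short_roots dot Phi0)
                        (fun a => int_coset (p a) q)
                  `|` affine_union (long_roots dot Phi0)
                        (fun a => int_coset (p a) (m * q))])]).
Proof.
move=> GrPsi; have m_prime : prime m by case: m23 => ->.
have [PsiPhi _ _] := Psi_subsystem.
split=> [Psi_max|[[Gr_max Gr_neq ->]|[GrPhi [p [plin Psi_p Psi_eq]]]]].
- have [GrPhi|Gr_neq] := EM (GrPsi = Phi0); [right; split=> //|left].
    have [p [q [q_pr plin Psi_p Psi_eq]]] :=
      maximal_full_gradient Phi0_root Phi0_reduced Phi0_irreducible
        m_lacing m_prime Psi_max GrPhi.
    exists p; rewrite GrPhi; split=> // [a Pa|].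
      have Pap := Psi_p a Pa; split=> //.
      by apply/LambdaP => //; have /twistedP[] := PsiPhi _ Pap.
    have [qm|qm] := eqVneq q m.
      by left; rewrite Psi_eq qm congruence_system_lacing.
    have mq : coprime m q by rewrite prime_coprime // dvdn_prime2 // eq_sym.
    by right; exists q; split=> //; rewrite Psi_eq congruence_system_coprime.
  exact: maximal_proper_gradient.
- exact: full_lift_maximal.
- have {}Psi_p a : Phi0 a -> Psi (a, (p a)%:~R).
    by rewrite -{1}GrPhi => /Psi_p[].
  have mp := section_long_divisible PsiPhi Psi_p.
  rewrite GrPhi in plin.
  have [q q_pr ->] :
      exists2 q, prime q & Psi = congruence_system dot Phi0 m p q.
    case: Psi_eq => [->|[q [q_pr mq ->]]].
      by exists m => //; rewrite congruence_system_lacing.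
    by exists q => //; rewrite congruence_system_coprime.
  exact: congruence_system_maximal.
Qed.
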